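(* Let $\theta>0$, $c(\theta)=1+2/\theta$ and $\mu>0$. On the event $(1+\theta)\,d_1^2(PE)\le\mu$, we have for every $p\times n$ matrix $B$ $$\|X\hat A-XA\|_F^2\le c^2(\theta)\,\|XB-XA\|_F^2+2c(\theta)\,\mu\, r(B).$$ In particular, whenever $\mu\ge(1+\theta)d_1^2(PE)$, $$\|X\hat A-XA\|_F^2\le\min_{0\le k\le\min(n,p)}\left\{c^2(\theta)\sum_{j>k}d_j^2(XA)+2c(\theta)\mu k\right\}$$ and $$\|X\hat A-XA\|_F^2\le 2c(\theta)\,\mu\, r,\qquad r=r(A).$$
   Context: Multivariate response regression model: $Y=XA+E$, where $Y$ is the $m\times n$ response matrix, $X$ is an $m\times p$ matrix, $A$ is an unknown $p\times n$ matrix, and $E$ is a random $m\times n$ matrix with independent entries of mean zero and variance $\sigma^2$. $P$ is the orthogonal projection matrix onto the column space of $X$. For a matrix $C$, $r(C)$ is its rank, $\|C\|_F$ its Frobenius norm, and $d_1(C)\ge d_2(C)\ge\cdots$ its singular values in decreasing order ($d_j(C)=0$ for $j$ larger than the rank of $C$). The Rank Selection Criterion (RSC) estimator $\hat A$ with tuning parameter $\mu>0$ is a minimizer of $\|Y-XB\|_F^2+\mu\, r(B)$ over all $p\times n$ matrices $B$. *)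

(* Defs.v *)
From HB Require Import structures.
From mathcomp Require Import all_boot all_order all_algebra.
From mathcomp Require Import all_classical all_reals all_analysis.
From mathcomp Require Import polyrcf.

Set Implicit Arguments.
Unset Strict Implicit.
Unset Printing Implicit Defensive.

Import Order.TTheory GRing.Theory Num.Theory.
Import numFieldNormedType.Exports.

Local Open Scope classical_set_scope.
Local Open Scope ring_scope.

Definition frob (R : realType) (m n : nat) (C : 'M[R]_(m, n)) : R :=
  Num.sqrt (\sum_(i < m) \sum_(j < n) C i j ^+ 2).

(* [rootsR] lists each real root once, whence the repetition according to the
   multiplicity [mup x p]. The eigenvalues of [C^T *m C] being real, the result
   has [n] entries, the last of them possibly 0. *)
Definition singvals (R : realType) (m n : nat) (C : 'M[R]_(m, n)) : seq R :=
  let p := char_poly (C^T *m C) in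
  sort (fun x y => y <= x)
    [seq Num.sqrt x | x <- flatten [seq nseq (mup x p) x | x <- rootsR p]].

(* The index starts at 1, as in d_1 >= d_2 >= ...; the value is 0 past the
   end of [singvals C]. *)
Definition singval (R : realType) (m n : nat) (j : nat) (C : 'M[R]_(m, n)) : R :=
  (singvals C)`_j.-1.

(* MathComp works with row spaces: the row space of [X^T] is the column space
   of [X], and that of [kermx X] is its orthogonal complement. *)
Definition orthproj (R : realType) (m p : nat) (X : 'M[R]_(m, p)) : 'M[R]_m :=
  (proj_mx <<X^T>>%MS (kermx X))^T.

Lemma capmx_colspace_kermx (R : realType) (m p : nat) (X : 'M[R]_(m, p)) :
  (<<X^T>> :&: kermx X)%MS = 0.
Proof.
apply/eqP; rewrite -submx0; apply/rV_subP => u.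
rewrite sub_capmx genmxE => /andP[/submxP[w uE] /sub_kermxP uX0].
have u2 : \sum_i u 0 i ^+ 2 = 0.
  have : (u *m (w *m X^T)^T) 0 0 = 0.
    by rewrite trmx_mul trmxK mulmxA uX0 mul0mx mxE.
  rewrite -uE mxE => u0; rewrite -[RHS]u0.
  by apply: eq_bigr => i _; rewrite mxE expr2.
suff -> : u = 0 by rewrite sub0mx.
apply/rowP => i; rewrite mxE; apply/eqP; rewrite -sqrf_eq0.
by apply/eqP; apply: (psumr_eq0P _ u2) => // j _; exact: sqr_ge0.
Qed.

Lemma orthproj_id (R : realType) (m p : nat) (X : 'M[R]_(m, p)) (q : nat)
  (W : 'M[R]_(p, q)) : orthproj X *m (X *m W) = X *m W.
Proof.
rewrite /orthproj; apply: trmx_inj; rewrite trmx_mul trmxK.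
by rewrite proj_mx_id ?capmx_colspace_kermx// genmxE trmx_mul submxMl.
Qed.

Lemma orthproj_0 (R : realType) (m p : nat) (X : 'M[R]_(m, p)) (q : nat)
  (Z : 'M[R]_(m, q)) : X^T *m Z = 0 -> orthproj X *m Z = 0.
Proof.
move=> XZ; rewrite /orthproj; apply: trmx_inj; rewrite trmx_mul trmxK trmx0.
rewrite proj_mx_0 ?capmx_colspace_kermx//; apply/sub_kermxP.
by rewrite -[X in _ *m X]trmxK -trmx_mul XZ trmx0.
Qed.

Definition rsc_objective (R : realType) (m n p : nat) (mu : R)
    (X : 'M[R]_(m, p)) (Y : 'M[R]_(m, n)) (B : 'M[R]_(p, n)) : R :=
  frob (Y - X *m B) ^+ 2 + mu * (\rank B)%:R.

Definition is_rsc (R : realType) (m n p : nat) (mu : R)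
    (X : 'M[R]_(m, p)) (Y : 'M[R]_(m, n)) (Ahat : 'M[R]_(p, n)) : Prop :=
  forall B : 'M[R]_(p, n), rsc_objective mu X Y Ahat <= rsc_objective mu X Y B.

Definition mutually_independent (R : realType) (d : measure_display)
    (Omega : measurableType d) (Pr : probability Omega R) (I : finType)
    (Z : I -> {RV Pr >-> R}) : Prop :=
  forall (S : {set I}) (B : I -> set R), (forall i, measurable (B i)) ->
    (Pr (\big[setI/setT]_(i in S) (Z i @^-1` B i))
      = \prod_(i in S) Pr (Z i @^-1` B i))%E.

Definition noise_model (R : realType) (d : measure_display)
    (Omega : measurableType d) (Pr : probability Omega R) (m n : nat)
    (sigma : R) (E : 'I_m -> 'I_n -> {RV Pr >-> R}) : Prop :=
  [/\ mutually_independent (fun ij : 'I_m * 'I_n => E ij.1 ij.2),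
      forall i j, ('E_Pr[E i j] = 0)%E
    & forall i j, ('V_Pr[E i j] = (sigma ^+ 2)%:E)%E].

Definition mx_at (R : realType) (d : measure_display)
    (Omega : measurableType d) (Pr : probability Omega R) (m n : nat)
    (E : 'I_m -> 'I_n -> {RV Pr >-> R}) (w : Omega) : 'M[R]_(m, n) :=
  \matrix_(i < m, j < n) E i j w.

Definition c_of (R : realType) (theta : R) : R := 1 + 2 / theta.

(* The minimum of [F 0], ..., [F N], both ends included. *)
Definition min_upto (R : realType) (N : nat) (F : nat -> R) : R :=
  \big[Num.min/F 0%N]_(k < N.+1) F k.

(* Main.v *)
(* Fix a competitor B and put M = X Ahat - X A, N = X B - X A. Optimality of Ahat
   bounds |M|^2 by |N|^2 + 2 <E, M - N> + mu (r(B) - r(Ahat)), where E may be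
   replaced by PE. Let Q be the orthogonal projection onto the row space of M - N:
   then <PE, M - N> = <(PE) Q, M> - <(PE) Q, N> and |(PE) Q|^2 is at most
   d_1(PE)^2 (r(Ahat) + r(B)). Young's inequality with weight 1 + theta/2 on the
   first inner product and theta/2 on the second gives the oracle inequality. The
   second bound takes B = A V with V the orthogonal projection onto the span of k
   leading right singular vectors of XA, and the third takes B = A. *)
Require Import Defs.
From HB Require Import structures.
From mathcomp Require Import all_boot all_order all_algebra.
From mathcomp Require Import all_classical all_reals all_analysis.
From mathcomp Require Import fingroup perm spectral complex polyrcf ring lra.

Set Implicit Arguments.
Unset Strict Implicit.
Unset Printing Implicit Defensive.

Import Order.TTheory GRing.Theory Num.Theory.
Import numFieldNormedType.Exports.

Local Open Scope classical_set_scope.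
Local Open Scope ring_scope.

(** * Spectral theorem for real symmetric matrices *)

Lemma rV_gramE (R : realDomainType) (n : nat) (v : 'rV[R]_n) :
  (v *m v^T) 0 0 = \sum_i v 0 i ^+ 2.
Proof. by rewrite mxE; apply: eq_bigr => i _; rewrite mxE expr2. Qed.

Lemma rV_gram_eq0 (R : realDomainType) (n : nat) (v : 'rV[R]_n) :
  (v *m v^T) 0 0 = 0 -> v = 0.
Proof.
rewrite rV_gramE => s0; apply/rowP => i; rewrite mxE; apply/eqP.
by rewrite -sqrf_eq0; apply/eqP; apply: (psumr_eq0P _ s0) => // j _; exact: sqr_ge0.
Qed.

(* S is hermitian over R[i], so the eigenvalue it has there is real. *)
Lemma real_eigenvalue (R : rcfType) (n : nat) (S : 'M[R]_n) :
  (0 < n)%N -> S^T = S -> exists a, eigenvalue S a.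
Proof.
move=> n0 Ssym; pose T := map_mx (real_complex R) S.
have [a /eigenvalueP[v vT v0]] := eigenvalue_closed T n0.
pose w := map_mx Num.conj v.
have TC : map_mx Num.conj T = T.
  by apply/matrixP => i j; rewrite !mxE; exact: conjc_real.
have wT : w *m T = a^* *: w by rewrite -{1}TC -map_mxM vT map_mxZ.
have vw : (v *m w^T) 0 0 != 0.
  rewrite mxE; under eq_bigr do rewrite !mxE -normCK.
  apply: contra v0 => /eqP s0; apply/eqP/rowP => i; rewrite mxE.
  apply/eqP; rewrite -normr_eq0 -sqrf_eq0; apply/eqP.
  by apply: (psumr_eq0P _ s0) => // j _; exact: exprn_ge0.
(* Evaluating v T w^T from the left gives the factor [a], from the right its conjugate. *)
have aR : a^* = a.
  apply: (mulIf vw); have : v *m T *m w^T = v *m (w *m T)^T.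
    by rewrite trmx_mul mulmxA; congr (_ *m _ *m _); rewrite map_trmx Ssym.
  by rewrite vT wT linearZ/= -scalemxAl -scalemxAr => /matrixP/(_ 0 0); rewrite !mxE.
have /complex_realP[b ab] : a \is Num.real by apply/CrealP.
exists b; rewrite eigenvalue_root_char -(fmorph_root (real_complex R)).
rewrite map_char_poly -eigenvalue_root_char; apply/eigenvalueP; exists v => //.
exact: etrans vT (congr1 (fun z => z *: v) ab).
Qed.

(** Serves to carry the first basis vector to a unit eigenvector. The case [e = v] is separate
    because the reflection divides by |e - v|^2. *)
Lemma householder (R : rcfType) (n : nat) (e v : 'rV[R]_n) :
  e *m e^T = 1%:M -> v *m v^T = 1%:M ->
  exists H : 'M[R]_n, H *m H^T = 1%:M /\ e *m H = v.
Proof.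
move=> e1 v1.
have [<-|ve] := eqVneq e v.
  by exists 1%:M; rewrite trmx1 !mulmx1.
have [w wE] : exists w, w = e - v by exists (e - v).
pose t := (w *m w^T) 0 0.
have t0 : t != 0.
  by apply: contra ve => /eqP/rV_gram_eq0/eqP; rewrite wE subr_eq0.
have tE : w *m w^T = t%:M by rewrite [LHS]mx11_scalar.
(* For unit vectors, |e - v|^2 = 2 - 2 <e, v> = 2 <e, e - v>. *)
have ew : 2 *: (e *m w^T) = t%:M.
  rewrite -tE wE linearB/= !mulmxBl !mulmxBr e1 v1.
  have -> : v *m e^T = e *m v^T.
    by rewrite [LHS]mx11_scalar -tr_scalar_mx -mx11_scalar trmx_mul trmxK.
  by move: (e *m v^T) => x; apply/matrixP => i j; rewrite !mxE; ring.
(* The reflection in the hyperplane orthogonal to w exchanges e and v. *)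
exists (1%:M - (2 / t) *: (w^T *m w)); split.
  have -> : (1%:M - (2 / t) *: (w^T *m w))^T = 1%:M - (2 / t) *: (w^T *m w).
    apply/matrixP => i j; rewrite !mxE eq_sym; congr (_ - _ * _).
    by apply: eq_bigr => k _; rewrite !mxE mulrC.
  rewrite mulmxBl mul1mx mulmxBr mulmx1.
  rewrite -scalemxAr -scalemxAl scalerA -mulmxA (mulmxA w) tE mul_scalar_mx.
  rewrite -scalemxAr scalerA (_ : 2 / t * (2 / t) * t = 2 / t + 2 / t); last by field.
  by rewrite scalerDl; move: (_ *: _) => x; apply/matrixP => i j; rewrite !mxE; ring.
rewrite mulmxBr mulmx1 -scalemxAr mulmxA scalemxAl.
rewrite (_ : (2 / t) *: (e *m w^T) = 1%:M); first by rewrite mul1mx wE subKr.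
by rewrite [2 / t]mulrC -scalerA ew scale_scalar_mx mulVf.
Qed.

(** Deflation: in an orthonormal basis starting with a unit eigenvector, the first row of the matrix
    is [a] times the first basis vector. Symmetry clears the first column too, and induction handles
    the lower right block. *)
Lemma symmetric_spectral (R : rcfType) (n : nat) (S : 'M[R]_n) :
  S^T = S -> exists (U : 'M[R]_n) (l : 'rV[R]_n),
    U *m U^T = 1%:M /\ S = U^T *m diag_mx l *m U.
Proof.
elim: n S => [|n IHn] S Ssym.
  by exists 1%:M, 0; split; apply/matrixP => -[].
rewrite -[n.+1]/(1 + n)%N in S Ssym *.
have [a /eigenvalueP[v vS v0]] := real_eigenvalue (ltn0Sn n) Ssym.
pose s := (v *m v^T) 0 0.
have s_ge0 : 0 <= s by rewrite /s rV_gramE sumr_ge0// => i _; exact: sqr_ge0.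
have s0 : s != 0 by apply: contra v0 => /eqP/rV_gram_eq0 ->.
have [H [HH eH]] : exists H : 'M[R]_(1 + n),
    H *m H^T = 1%:M /\ delta_mx 0 0 *m H = (Num.sqrt s)^-1 *: v.
  apply: householder.
    by rewrite trmx_delta mul_delta_mx; apply/matrixP => i j; rewrite !ord1 !mxE.
  rewrite linearZ/= -scalemxAl -scalemxAr scalerA.
  rewrite [v *m _]mx11_scalar -/s scale_scalar_mx -invfM -expr2 sqr_sqrtr//.
  by rewrite mulVf.
have HH' := mulmx1C HH.
have [M ME] : exists M, M = H *m S *m H^T by exists (H *m S *m H^T).
have SE : S = H^T *m M *m H.
  by rewrite ME !mulmxA HH' mul1mx -mulmxA HH' mulmx1.
have Msym : M^T = M by rewrite ME !trmx_mul trmxK Ssym mulmxA.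
have M0 : row 0 M = a *: delta_mx 0 0.
  rewrite rowE ME !mulmxA eH -scalemxAl vS scalerA mulrC -scalerA -eH.
  by rewrite -scalemxAl -mulmxA HH mulmx1.
have l0 : lshift n (0 : 'I_1) = 0 by exact/val_inj.
have ul : ulsubmx M = a%:M.
  apply/matrixP => i j; rewrite !ord1 !mxE l0 /= mulr1n.
  by move/rowP/(_ 0): M0; rewrite !mxE /= mulr1.
have ur : ursubmx M = 0.
  apply/rowP => j; rewrite !mxE l0.
  by move/rowP/(_ (rshift 1 j)): M0; rewrite !mxE /= mulr0.
have dl : dlsubmx M = 0 by rewrite -[M]Msym -trmx_ursub ur trmx0.
have [U [l [UU drE]]] : exists (U : 'M[R]_n) (l : 'rV[R]_n),
    U *m U^T = 1%:M /\ drsubmx M = U^T *m diag_mx l *m U.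
  by apply: IHn; rewrite trmx_drsub Msym.
have [V VE] : exists V : 'M[R]_(1 + n), V = block_mx 1%:M 0 0 U.
  by exists (block_mx 1%:M 0 0 U).
exists (V *m H), (row_mx a%:M l); split.
  rewrite trmx_mul mulmxA -(mulmxA V) HH mulmx1 VE tr_block_mx mulmx_block.
  by rewrite !trmx0 trmx1 !mulmx0 !mul0mx !addr0 add0r mulmx1 UU -scalar_mx_block.
rewrite SE trmx_mul !mulmxA; congr (_ *m _); rewrite -!mulmxA; congr (_ *m _).
rewrite -[M]submxK ul ur dl drE VE tr_block_mx diag_mx_row !mulmx_block.
rewrite !trmx0 trmx1 !mulmx0 !mul0mx !addr0 !add0r !mul1mx !mulmx1 !mulmxA.
congr block_mx; last by rewrite mulmx0.
by apply/matrixP => i j; rewrite !ord1 !mxE eqxx mulr1n.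
Qed.

(** * Singular values and the spectrum of the Gram matrix *)

Lemma char_poly_conj_diag (F : comUnitRingType) (n : nat) (U : 'M[F]_n)
    (l : 'rV[F]_n) :
  U *m U^T = 1%:M ->
  char_poly (U^T *m diag_mx l *m U) = \prod_(i < n) ('X - (l 0 i)%:P).
Proof.
move=> UU; have UU' := mulmx1C UU.
pose f (A : 'M[F]_n) := map_mx (@polyC F) A.
have -> : char_poly (U^T *m diag_mx l *m U) = \det (f U^T *m char_poly_mx (diag_mx l) *m f U).
  rewrite /char_poly /char_poly_mx mulmxBr mulmxBl -!map_mxM scalar_mxC.
  by rewrite -(mulmxA 'X%:M) -map_mxM UU' map_mx1 mulmx1.
rewrite !det_mulmx mulrAC -det_mulmx -map_mxM UU' map_mx1 det1 mul1r.
rewrite -/(char_poly _) char_poly_trig ?diag_mx_is_trig//.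
by apply: eq_bigr => i _; rewrite mxE eqxx mulr1n.
Qed.

(** Links the encoding of [singvals] to an explicit factorization: in a product of linear factors,
    [mup] counts the occurrences in [s]. *)
Lemma rootsR_mup_perm (R : rcfType) (s : seq R) (p := \prod_(x <- s) ('X - x%:P)) :
  perm_eq (flatten [seq nseq (mup x p) x | x <- rootsR p]) s.
Proof.
have p0 : p != 0 by rewrite monic_neq0// monic_prod_XsubC.
have ps : perm_eq (rootsR p) (undup s).
  apply: uniq_perm; [exact: uniq_roots|exact: undup_uniq|move=> x].
  by rewrite mem_undup -roots_on_rootsR// inE root_prod_XsubC.
under eq_map do rewrite mu_prod_XsubC.
by apply: perm_trans (perm_count_undup s); apply: perm_flatten; apply: perm_map.
Qed.

(** The spectral theorem yields the eigenvalues in arbitrary order; permuting the rows of the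
    orthogonal matrix sorts them as in [singvals]. *)
Lemma gram_spectral (R : realType) (m n : nat) (C : 'M[R]_(m, n)) :
  exists U : 'M[R]_n, U *m U^T = 1%:M /\
    C^T *m C = U^T *m diag_mx (\row_j singval j.+1 C ^+ 2) *m U.
Proof.
have [|U [l [UU CE]]] := @symmetric_spectral R n (C^T *m C).
  by rewrite trmx_mul trmxK.
(* Each eigenvalue is the squared norm of a column of C U^T, so squaring its square root gives it
   back. *)
have l_ge0 i : 0 <= l 0 i.
  have -> : l 0 i = ((C *m U^T)^T *m (C *m U^T)) i i.
    rewrite trmx_mul trmxK mulmxA -(mulmxA U) CE !mulmxA UU mul1mx -mulmxA UU mulmx1.
    by rewrite mxE eqxx mulr1n.
  by rewrite mxE sumr_ge0// => k _; rewrite mxE -expr2 sqr_ge0.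
pose t := [tuple Num.sqrt (l 0 i) | i < n].
have /tuple_permP[s sE] : perm_eq (singvals C) t.
  have pE : char_poly (C^T *m C) = \prod_(x <- [seq l 0 i | i <- enum 'I_n]) ('X - x%:P).
    by rewrite CE char_poly_conj_diag// big_map big_enum.
  rewrite /singvals perm_sort pE.
  have -> : tval t = [seq Num.sqrt x | x <- [seq l 0 i | i <- enum 'I_n]].
    by rewrite -map_comp.
  by apply: perm_map; exact: rootsR_mup_perm.
have dE (i : 'I_n) : singval i.+1 C ^+ 2 = l 0 (s i).
  rewrite /singval /= sE (nth_map i) ?size_enum_ord// nth_ord_enum.
  by rewrite !tnth_mktuple sqr_sqrtr.
exists (row_perm s U); split.
  rewrite row_permE trmx_mul mulmxA -(mulmxA (perm_mx s)) UU mulmx1.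
  by rewrite tr_perm_mx -perm_mxM mulgV perm_mx1.
rewrite CE; apply/matrixP => i j; rewrite !mul_mx_diag !mxE.
rewrite [LHS](reindex s)/=; last by exists (s^-1)%g => k _; rewrite ?permK ?permKV.
by apply: eq_bigr => k _; rewrite !mxE dE.
Qed.

Lemma singval_le1 (R : realType) (m n j : nat) (C : 'M[R]_(m, n)) :
  singval j C ^+ 2 <= singval 1 C ^+ 2.
Proof.
have d_ge0 k : 0 <= singval k C.
  have [ks|ks] := ltnP k.-1 (size (singvals C)); last by rewrite /singval nth_default.
  by have := mem_nth 0 ks; rewrite mem_sort => /mapP[x _]; rewrite /singval => ->; exact: sqrtr_ge0.
rewrite ler_sqr ?nnegrE//.
(* Past the end of the list the default 0 is below the nonnegative first value; within the list,
   sortedness decides. *)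
have [js|js] := ltnP j.-1 (size (singvals C)); last by rewrite {1}/singval nth_default.
have := sort_sorted (fun x y : R => le_total y x)
  [seq Num.sqrt x | x <- flatten [seq nseq (mup x (char_poly (C^T *m C))) x
                                 | x <- rootsR (char_poly (C^T *m C))]].
move/(sorted_leq_nth (fun y x z xy yz => le_trans yz xy) (@lexx _ R) 0).
by apply; rewrite ?inE// (leq_ltn_trans _ js).
Qed.

(** * The Frobenius norm through the trace inner product *)

Lemma frob_sqrE (R : realType) (m n : nat) (C : 'M[R]_(m, n)) :
  frob C ^+ 2 = \tr (C^T *m C).
Proof.
rewrite /frob sqr_sqrtr; last by do 2!(apply: sumr_ge0 => ? _); exact: sqr_ge0.
rewrite exchange_big /mxtrace; apply: eq_bigr => j _.
by rewrite mxE; apply: eq_bigr => i _; rewrite mxE expr2.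
Qed.

Lemma mxtrace_gramC (R : comPzRingType) (m n : nat) (A B : 'M[R]_(m, n)) :
  \tr (A^T *m B) = \tr (B^T *m A).
Proof. by rewrite -mxtrace_tr trmx_mul trmxK. Qed.

Lemma mxtrace_gramBl (R : comPzRingType) (m n : nat) (A B C : 'M[R]_(m, n)) :
  \tr ((A - B)^T *m C) = \tr (A^T *m C) - \tr (B^T *m C).
Proof. by rewrite [(A - B)^T]linearB mulmxBl [LHS]linearB. Qed.

Lemma frob_sqrB (R : realType) (m n : nat) (A B : 'M[R]_(m, n)) :
  frob (A - B) ^+ 2 = frob A ^+ 2 - 2 * \tr (B^T *m A) + frob B ^+ 2.
Proof.
rewrite !frob_sqrE mxtrace_gramBl ![\tr (_ *m (A - B))]mxtrace_gramC.
by rewrite !mxtrace_gramBl (mxtrace_gramC A B); ring.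
Qed.

Lemma frob_sqrZ (R : realType) (m n : nat) (a : R) (C : 'M[R]_(m, n)) :
  frob (a *: C) ^+ 2 = a ^+ 2 * frob C ^+ 2.
Proof.
by rewrite !frob_sqrE [(a *: C)^T]linearZ -scalemxAr -scalemxAl scalerA mxtraceZ expr2.
Qed.

Lemma frobN (R : realType) (m n : nat) (C : 'M[R]_(m, n)) : frob (- C) = frob C.
Proof.
by congr Num.sqrt; apply: eq_bigr => i _; apply: eq_bigr => j _; rewrite mxE sqrrN.
Qed.

(** Young's inequality: expand 0 <= |a A - B|^2 and divide by [a]. *)
Lemma mxtrace_gram_le (R : realType) (m n : nat) (a : R) (A B : 'M[R]_(m, n)) :
  0 < a -> 2 * \tr (B^T *m A) <= a * frob A ^+ 2 + frob B ^+ 2 / a.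
Proof.
move=> a0; have := sqr_ge0 (frob (a *: A - B)).
rewrite frob_sqrB frob_sqrZ -scalemxAr mxtraceZ.
move: (frob A ^+ 2) (frob B ^+ 2) (\tr _) => x y t h.
rewrite -(ler_pM2l a0) mulrDr (mulrCA a y) mulfV ?gt_eqF// mulr1; lra.
Qed.

(** In the right singular basis, [C] weights the squared entries of row i of U M by the square of
    its singular value, and [U] preserves the Frobenius norm. *)
Lemma frob_mulmx_le (R : realType) (m n q : nat) (C : 'M[R]_(m, n))
    (M : 'M[R]_(n, q)) :
  frob (C *m M) ^+ 2 <= singval 1 C ^+ 2 * frob M ^+ 2.
Proof.
have [U [UU CE]] := gram_spectral C.
have [W WE] : exists W, W = U *m M by exists (U *m M).
have -> : frob M ^+ 2 = frob W ^+ 2.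
  by rewrite !frob_sqrE WE trmx_mul -mulmxA (mulmxA U^T) (mulmx1C UU) mul1mx.
have -> : frob (C *m M) ^+ 2 = \sum_(j < q) \sum_(i < n) singval i.+1 C ^+ 2 * W i j ^+ 2.
  rewrite frob_sqrE trmx_mul -mulmxA (mulmxA C^T) CE -!mulmxA -WE mulmxA.
  rewrite -trmx_mul -WE /mxtrace; apply: eq_bigr => j _.
  rewrite mxE; apply: eq_bigr => i _; rewrite mul_diag_mx !mxE; ring.
rewrite frob_sqrE /mxtrace mulr_sumr; apply: ler_sum => j _.
rewrite mxE mulr_sumr; apply: ler_sum => i _.
by rewrite mxE -expr2 ler_wpM2r ?sqr_ge0// singval_le1.
Qed.

(** * Orthogonal projections and their rank *)

Lemma orthproj_tr (R : realType) (m p : nat) (X : 'M[R]_(m, p)) :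
  X^T *m orthproj X = X^T.
Proof.
apply: trmx_inj; rewrite trmx_mul /orthproj !trmxK.
apply/eqP; rewrite -subr_eq0 -opprB oppr_eq0 -{1}[X]mul1mx -mulmxBl; apply/eqP/sub_kermxP.
rewrite -[X in _ - X]mul1mx; apply: proj_mx_compl_sub.
(* The two subspaces meet trivially and have dimensions r(X) and m - r(X), hence fill the whole
   space. *)
apply: submx_full; rewrite /row_full mxrank_disjoint_sum ?capmx_colspace_kermx//.
by rewrite genmxE mxrank_tr mxrank_ker subnKC ?rank_leq_row.
Qed.

Lemma orthproj_factor (R : realType) (m p : nat) (X : 'M[R]_(m, p)) :
  exists W, orthproj X = X *m W.
Proof.
have : (proj_mx <<X^T>>%MS (kermx X) <= X^T)%MS.
  by rewrite -[X in (X <= _)%MS]mul1mx (submx_trans (proj_mx_sub _ _ _))// genmxE.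
move=> /submxP[W WE]; by exists W^T; rewrite /orthproj WE trmx_mul trmxK.
Qed.

(** For a full rank factorization Q = K L, idempotency forces L K to be the identity of size r(Q);
    the trace is cyclic. *)
Lemma mxtrace_idempotent (F : fieldType) (n : nat) (Q : 'M[F]_n) :
  Q *m Q = Q -> \tr Q = (\rank Q)%:R.
Proof.
move=> QQ; have -> : \tr Q = \tr (row_base Q *m col_base Q).
  by rewrite mxtrace_mulC mulmx_base.
suff -> : row_base Q *m col_base Q = 1%:M by rewrite mxtrace1.
apply: (row_free_inj (row_base_free Q)); apply: (row_full_inj (col_base_full Q)).
by rewrite /= mul1mx -mulmxA mulmxA mulmx_base QQ.
Qed.

(** For an orthogonal projection the squared Frobenius norm is the trace, hence the rank. The form
    [M *m Q^T] lets a rotation of the trace put [Q] to the right of the noise. *)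
Lemma rank_projector (R : realType) (m n : nat) (M : 'M[R]_(m, n)) :
  exists2 Q : 'M[R]_n, M *m Q^T = M & frob Q ^+ 2 <= (\rank M)%:R.
Proof.
have [W QE] := orthproj_factor M^T; set Q := orthproj M^T in QE.
have MQ : M *m Q = M by have := orthproj_tr M^T; rewrite trmxK.
have QQ : Q *m Q = Q by rewrite {2}QE orthproj_id -QE.
exists Q^T; first by rewrite trmxK.
have -> : frob Q^T ^+ 2 = \tr Q.
  rewrite frob_sqrE trmxK mxtrace_mulC {1}QE trmx_mul trmxK -mulmxA MQ.
  by rewrite -{1}[M]trmxK -trmx_mul -QE mxtrace_tr.
by rewrite mxtrace_idempotent// ler_nat QE (leq_trans (mxrankM_maxl _ _))// mxrank_tr.
Qed.

(** * The oracle inequality *)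

Lemma rsc_oracle (R : realType) (m n p : nat) (X : 'M[R]_(m, p))
    (A Ahat B : 'M[R]_(p, n)) (E : 'M[R]_(m, n)) (theta mu : R) :
  0 < theta -> is_rsc mu X (X *m A + E) Ahat ->
  (1 + theta) * singval 1 (orthproj X *m E) ^+ 2 <= mu ->
  frob (X *m Ahat - X *m A) ^+ 2
    <= c_of theta ^+ 2 * frob (X *m B - X *m A) ^+ 2
       + 2 * c_of theta * mu * (\rank B)%:R.
Proof.
move=> th0 /(_ B); rewrite /rsc_objective.
(* With residuals in this form, |E|^2 cancels between the two objectives. *)
have resE D : X *m A + E - X *m D = E - (X *m D - X *m A).
  by rewrite opprB addrCA addrA.
rewrite !resE !(frob_sqrB E).
set M := X *m Ahat - X *m A; set N := X *m B - X *m A => rsc hd.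
set G := orthproj X *m E in hd.
have [Q MQ Qr] := rank_projector (M - N).
have crossE : \tr (M^T *m E) - \tr (N^T *m E)
    = \tr (M^T *m (G *m Q)) + \tr ((- N)^T *m (G *m Q)).
  rewrite -mxtrace_gramBl; transitivity (\tr ((M - N)^T *m G)).
    (* M - N has its columns in the column space of X, so the projection can be inserted before
       [E]. *)
    have -> : M - N = X *m (Ahat - B) by rewrite mulmxBr opprB addrA subrK.
    by rewrite trmx_mul /G -!mulmxA (mulmxA X^T) orthproj_tr.
  rewrite -{1}MQ trmx_mul trmxK -mulmxA mxtrace_mulC -mulmxA mxtrace_gramBl.
  by rewrite [(- N)^T]linearN mulNmx raddfN.
have rMN : (\rank (M - N))%:R <= (\rank Ahat + \rank B)%:R :> R.
  rewrite ler_nat; have -> : M - N = X *m Ahat - X *m B by rewrite /M /N opprB addrA subrK.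
  apply: leq_trans (mxrank_add _ _) _; rewrite mxrank_opp.
  by apply: leq_add; exact: mxrankM_maxr.
have GQ : (1 + theta) * frob (G *m Q) ^+ 2 <= mu * (\rank Ahat + \rank B)%:R.
  apply: le_trans (_ : _ <= (1 + theta) * (singval 1 G ^+ 2 * frob Q ^+ 2)) _.
    by rewrite ler_pM2l ?addr_gt0// frob_mulmx_le.
  rewrite mulrA ler_pM ?sqr_ge0//; last exact: le_trans rMN.
  by rewrite mulr_ge0 ?sqr_ge0// ltW// addr_gt0.
(* The two Young weights add up to 1 + theta, the factor in [GQ]. The term mu r(Ahat) produced there
   then cancels against the penalty, leaving 2 mu r(B) in [key]. *)
have th2 : 0 < theta / 2 by rewrite divr_gt0.
have a0 : 0 < 1 + theta / 2 by rewrite addr_gt0.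
have hM := mxtrace_gram_le (G *m Q) M a0.
have hN := mxtrace_gram_le (G *m Q) (- N) th2.
rewrite frobN in hN; rewrite natrD in GQ.
move: rsc crossE GQ hM hN; rewrite /c_of.
move: (\tr (M^T *m E)) (\tr (N^T *m E)) (\tr (M^T *m _)) (\tr ((- N)^T *m _)) => t1 t2 t3 t4.
move: (frob M ^+ 2) (frob N ^+ 2) (frob E ^+ 2) (frob (G *m Q) ^+ 2) => x z e g.
move: (\rank Ahat)%:R (\rank B)%:R => ra rb rsc crossE GQ hM hN.
have key : x * (1 - (1 + theta / 2)^-1) <= (1 + 2 / theta) * z + 2 * mu * rb.
  rewrite invf_div in hN; lra.
(* The coefficient of |M|^2 in [key] is 1 / c(theta); multiplying by c(theta) isolates |M|^2. *)
have cE : (1 + 2 / theta) * (1 - (1 + theta / 2)^-1) = 1.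
  by field; apply/andP; split; rewrite gt_eqF// addr_gt0.
have c0 : 0 < 1 + 2 / theta by rewrite addr_gt0// divr_gt0.
have := ler_wpM2l (ltW c0) key; rewrite mulrCA cE mulr1 => /le_trans; apply.
by rewrite le_eqVlt; apply/orP; left; apply/eqP; ring.
Qed.

(** * Low rank competitors and the final bounds *)

(** The truncation acts on the right so that, for C = X A, the product C V is X times the competitor
    A V. *)
Lemma singval_truncation (R : realType) (m n k : nat) (C : 'M[R]_(m, n)) :
  (k <= n)%N ->
  exists2 V : 'M[R]_n, (\rank V <= k)%N &
    frob (C *m V - C) ^+ 2 = \sum_(k.+1 <= j < n.+1) singval j C ^+ 2.
Proof.
move=> kn; have [U [UU CE]] := gram_spectral C.
exists (U^T *m pid_mx k *m U).
  rewrite (leq_trans (mxrankM_maxl _ _))// (leq_trans (mxrankM_maxr _ _))//.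
  by rewrite rank_pid_mx.
have -> : C *m (U^T *m pid_mx k *m U) - C = - (C *m (U^T *m copid_mx k *m U)).
  by rewrite /copid_mx mulmxBr mulmxBl mulmx1 (mulmx1C UU) mulmxBr mulmx1 opprB.
set D := diag_mx _ in CE.
have [P PE] : exists P : 'M[R]_n, P = copid_mx k by exists (copid_mx k).
have PT : P^T = P by rewrite PE /copid_mx [LHS]linearB/= trmx1 tr_pid_mx.
have PP : P *m P = P by rewrite PE copid_mx_id.
rewrite -PE frobN frob_sqrE (trmx_mul C) -(mulmxA _ C^T) (mulmxA C^T) CE !trmx_mul trmxK PT.
have -> : U^T *m (P *m U) *m (U^T *m D *m U *m (U^T *m P *m U))
    = U^T *m (P *m D *m P *m U).
  by rewrite !mulmxA -(mulmxA _ U U^T) UU mulmx1 -(mulmxA _ U U^T) UU mulmx1.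
rewrite mxtrace_mulC -(mulmxA _ U) UU mulmx1 mxtrace_mulC mulmxA PP /D mul_mx_diag.
(* Diagonal entry i, counted from 0, holds the singular value of index i + 1; thus i >= k matches j
   > k. *)
rewrite big_add1 (big_nat_widenl _ 0)// big_mkord big_mkcond.
apply: eq_bigr => i _; rewrite PE !mxE !eqxx /=.
by case: leqP => _; rewrite ?subr0 ?subrr ?mul1r ?mul0r.
Qed.

Theorem theorem7 (R : realType) (d : measure_display)
    (Omega : measurableType d) (Pr : probability Omega R)
    (m n p : nat) (X : 'M[R]_(m, p)) (A : 'M[R]_(p, n)) (sigma : R)
    (E : 'I_m -> 'I_n -> {RV Pr >-> R}) (hE : noise_model sigma E)
    (Y : Omega -> 'M[R]_(m, n)) (hY : forall w, Y w = X *m A + mx_at E w)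
    (theta mu : R) (htheta : 0 < theta) (hmu : 0 < mu)
    (Ahat : Omega -> 'M[R]_(p, n)) (hAhat : forall w, is_rsc mu X (Y w) (Ahat w))
    (w : Omega)
    (hw : (1 + theta) * singval 1 (orthproj X *m mx_at E w) ^+ 2 <= mu) :
  [/\ forall B : 'M[R]_(p, n),
        frob (X *m Ahat w - X *m A) ^+ 2
          <= c_of theta ^+ 2 * frob (X *m B - X *m A) ^+ 2
             + 2 * c_of theta * mu * (\rank B)%:R,
      frob (X *m Ahat w - X *m A) ^+ 2
        <= min_upto (minn n p) (fun k =>
             c_of theta ^+ 2 * (\sum_(k.+1 <= j < n.+1) singval j (X *m A) ^+ 2)
             + 2 * c_of theta * mu * k%:R)
    & frob (X *m Ahat w - X *m A) ^+ 2
        <= 2 * c_of theta * mu * (\rank A)%:R].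
Proof.
have oracle B : frob (X *m Ahat w - X *m A) ^+ 2
    <= c_of theta ^+ 2 * frob (X *m B - X *m A) ^+ 2
       + 2 * c_of theta * mu * (\rank B)%:R.
  by apply: (@rsc_oracle _ _ _ _ _ _ _ _ (mx_at E w)) => //; rewrite -hY.
have c0 : 0 <= 2 * c_of theta * mu.
  by rewrite /c_of !mulr_ge0 ?ltW// addr_gt0// divr_gt0.
have truncated k : (k <= n)%N -> frob (X *m Ahat w - X *m A) ^+ 2
    <= c_of theta ^+ 2 * (\sum_(k.+1 <= j < n.+1) singval j (X *m A) ^+ 2)
       + 2 * c_of theta * mu * k%:R.
  move=> kn; have [V Vk VE] := singval_truncation (X *m A) kn.
  (* As r(A V) <= r(V) <= k and the penalty factor is nonnegative, the rank can be replaced by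
     [k]. *)
  have := oracle (A *m V); rewrite mulmxA VE => /le_trans; apply.
  rewrite lerD2l ler_wpM2l// ler_nat; exact: leq_trans (mxrankM_maxr _ _) Vk.
split=> //.
(* The starting value of the minimum is its term at 0, whence two goals; k <= min(n, p) gives k <=
   n. *)
- apply: le_bigmin => [|k _]; apply: truncated => //.
  by rewrite (leq_trans _ (geq_minl n p))// -ltnS.
- have frob0 : frob (X *m A - X *m A) = 0.
    rewrite subrr /frob big1 ?sqrtr0// => i _.
    by rewrite big1// => j _; rewrite mxE expr0n.
  by have := oracle A; rewrite frob0 expr0n mulr0 add0r.
Qed.
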